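(* Let $q$ be a power of a prime $p$ and let $r,s$ be positive integers with $s\equiv r+3\pmod{q+1}$. Let $B(x)\in\mathbb{F}_{q^2}[x]$ be such that $B(x)$ has no root in $\mu_{q+1}$ and $x\mapsto x^{r}B^{(q)}(1/x)/B(x)$ permutes $\mu_{q+1}$. Let $a\in\mathbb{F}_{q^2}\setminus\mathbb{F}_q$. Then $$x^{s}B(x^{q-1})\left(ax^{3(q-1)}+a^{q}\right)$$ permutes $\mathbb{F}_{q^2}$ if and only if $\gcd(s,q-1)=1$ and $-a^{q-1}\notin\mu_{\frac{q+1}{\gcd(q+1,3)}}$.
   Context: For a positive integer $d$ dividing $q+1$, $\mu_{d}$ denotes the set of $d$-th roots of unity in $\mathbb{F}_{q^2}$. For $B(x)\in\mathbb{F}_{q^2}[x]$, $B^{(q)}(x)$ denotes the polynomial obtained from $B(x)$ by raising every coefficient to the $q$-th power. A polynomial permutes a finite set if it induces a bijection of that set onto itself. *)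

(* Defs.v *)
From HB Require Import structures.
From mathcomp Require Import all_boot all_order all_algebra all_field.
Set Implicit Arguments.
Unset Strict Implicit.
Unset Printing Implicit Defensive.
Import GRing.Theory.
Local Open Scope ring_scope.

Definition mu (F : finFieldType) (d : nat) : {set F} :=
  [set x : F | d.-unity_root x].

Definition permutes (F : finFieldType) (S : {set F}) (f : F -> F) : Prop :=
  {in S &, injective f} /\ f @: S = S.

Definition coef_pow (F : finFieldType) (q : nat) (B : {poly F}) : {poly F} :=
  map_poly (fun c => c ^+ q) B.

(* Main.v *)
(** Write the polynomial as [f x = x^s h(x^(q-1))], with
    [h u = B u * (a u^3 + a^q)]. If [h] has no root in [mu_(q+1)], then
    [f x ^ (q-1) = g (x^(q-1))] with [g u = u^s h(u)^(q-1)]. On [mu_(q+1)] we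
    have [u^q = 1/u], so [(a u^3 + a^q)^q = u^-3 (a u^3 + a^q)] and [g] is the
    map [u^r B^(q)(1/u) / B u], which is injective by hypothesis; hence [f]
    permutes iff [gcd(s, q-1) = 1]. A root of [h] in [mu_(q+1)] gives a nonzero
    root of [f]. Since [-a^(q-1)] has to be a cube in [mu_(q+1)] for such a root
    to exist, its absence is the second condition. *)
Require Import Defs.
From HB Require Import structures.
From mathcomp Require Import all_boot all_order all_algebra all_field.
From mathcomp Require Import cyclic ring.
Set Implicit Arguments.
Unset Strict Implicit.
Unset Printing Implicit Defensive.
Import GRing.Theory.
Local Open Scope ring_scope.

(** The [#|F|.-1] nonzero elements are distinct roots of unity of that order, enough to force a
    primitive one. *)
Lemma finField_prim_root (F : finFieldType) :
  exists z : F, #|F|.-1.-primitive_root z.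
Proof.
pose rs := enum (predC1 (0 : F)).
have F_gt1 := finNzRing_gt1 F.
have szrs : size rs = #|F|.-1 by rewrite -cardE cardC1.
have /hasP[z _ prim_z] : has #|F|.-1.-primitive_root rs.
  apply: has_prim_root; rewrite ?szrs //; first by rewrite -subn1 subn_gt0.
    apply/allP=> x; rewrite mem_enum => x_neq0.
    apply/unity_rootP/(mulfI x_neq0).
    by rewrite -exprS mulr1 prednK ?expf_card // (ltn_trans _ F_gt1).
  exact: enum_uniq.
by exists z.
Qed.

(** With [d = gcdn n m], the hypothesis on [v = z ^+ i] forces [d] to divide [i]; by Bezout [d] is a
    multiple of [m] modulo [n], so [z ^+ d] is an [m]-th power. *)
Lemma prim_root_powP (F : fieldType) (n m : nat) (z v : F) :
    (0 < m)%N -> n.-primitive_root z ->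
  v ^+ (n %/ gcdn n m) = 1 -> exists2 w : F, w ^+ n = 1 & v = w ^+ m.
Proof.
move=> m_gt0 prim_z v1.
have n_gt0 := prim_order_gt0 prim_z.
set d := gcdn n m in v1 *.
have d_gt0 : (0 < d)%N by rewrite gcdn_gt0 n_gt0.
have dn : (d %| n)%N := dvdn_gcdl n m.
have nd_gt0 : (0 < n %/ d)%N by rewrite divn_gt0 // dvdn_leq.
have vn : v ^+ n = 1 by rewrite -(divnK dn) exprM v1 expr1n.
have [[i i_lt] /= def_v] := prim_rootP prim_z vn.
have /dvdnP[j def_i] : (d %| i)%N.
  move/eqP: v1; rewrite def_v -exprM -(prim_order_dvd prim_z).
  by rewrite -{1}(divnK dn) mulnC dvdn_pmul2r.
have [km kn def_d _] := egcdnP n m_gt0.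
exists (z ^+ (j * km)); first by rewrite exprAC (prim_expr_order prim_z) expr1n.
rewrite -exprM -mulnA def_d gcdnC -/d mulnDr exprD -def_i mulnA mulnC.
by rewrite exprM (prim_expr_order prim_z) expr1n mul1r def_v.
Qed.

(** The order of [x / y] divides the coprime numbers [m] and [n]. *)
Lemma expf_coprime_inj (F : fieldType) (m n : nat) (x y : F) :
    y != 0 -> (0 < m)%N -> gcdn m n = 1%N ->
  x ^+ m = y ^+ m -> x ^+ n = y ^+ n -> x = y.
Proof.
move=> y0 m_gt0 mn1 xm xn.
have tm : (x / y) ^+ m = 1 by rewrite expr_div_n xm divff // expf_neq0.
have tn : (x / y) ^+ n = 1 by rewrite expr_div_n xn divff // expf_neq0.
have [km kn def_d _] := egcdnP n m_gt0.
have : (x / y) ^+ (km * m) = 1 by rewrite mulnC exprM tm expr1n.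
rewrite def_d mn1 exprD mulnC exprM tn expr1n mul1r expr1.
by move/(canRL (divfK y0)); rewrite mul1r.
Qed.

Lemma horner_coef_pow (F : finFieldType) (q : nat) (B : {poly F}) (x : F) :
  [pchar F].-nat q -> B.[x] ^+ q = (coef_pow q B).[x ^+ q].
Proof.
move=> char_q; have q_gt0 : (0 < q)%N by case/andP: char_q.
rewrite /coef_pow /map_poly horner_poly horner_coef.
rewrite (big_morph (fun y : F => y ^+ q) (id1 := 0) (op1 := +%R)).
- by apply: eq_bigr => i _; rewrite exprMn exprAC.
- by move=> y z; rewrite exprDn_pchar.
- by rewrite expr0n eqn0Ngt q_gt0.
Qed.

Lemma permutes_setT (F : finFieldType) (f : F -> F) :
  permutes [set: F] f <-> injective f.
Proof.
split=> [[f_inj _] x y|f_inj]; first exact: f_inj (in_setT x) (in_setT y).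
split=> [x y _ _|]; first exact: f_inj.
by apply/eqP; rewrite eqEcard subsetT card_imset ?leqnn.
Qed.

Theorem theorem3p10 (p k q : nat) (hp : prime p) (hk : (0 < k)%N)
    (hq : q = (p ^ k)%N)
    (F : finFieldType) (hF : #|F| = (q ^ 2)%N)
    (Fq : {set F}) (hFq : divring_closed Fq) (hcardFq : #|Fq| = q)
    (r s : nat) (hr : (0 < r)%N) (hs : (0 < s)%N)
    (hrs : s = r + 3 %[mod q + 1])
    (B : {poly F})
    (hBroot : forall x : F, x \in mu F (q + 1) -> ~~ root B x)
    (hBperm : permutes (mu F (q + 1))
                (fun x : F => x ^+ r * (coef_pow q B).[x^-1] / B.[x]))
    (a : F) (ha : a \notin Fq) :
  permutes [set: F]
    (horner ('X^s * (B \Po 'X^(q - 1)) *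
             (a *: 'X^(3 * (q - 1)) + (a ^+ q)%:P)))
  <-> gcdn s (q - 1) = 1%N /\
      - a ^+ (q - 1) \notin mu F ((q + 1) %/ gcdn (q + 1) 3).
Proof.
set f := horner _.
have q_gt1 : (1 < q)%N by rewrite hq -(expn0 p) ltn_exp2l // prime_gt1.
have q_gt0 := ltnW q_gt1.
have q1_gt0 : (0 < q - 1)%N by rewrite subn_gt0.
have cardF1 : (#|F|.-1 = (q - 1) * (q + 1))%N.
  by rewrite -subn_sqr exp1n subn1 hF.
have [z] := finField_prim_root F; rewrite cardF1 => prim_z.
have char_q : [pchar F].-nat q.
  have pF : p \in [pchar F].
    by apply: (@card_finPcharP _ p (k * 2)) => //; rewrite hF hq expnM.
  rewrite hq pnatX; apply/orP; left.
  by apply: sub_in_pnat (pnat_id hp) => l _; rewrite inE => /eqP->.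
(* [Fq] contains [1 - 1 = 0]. *)
have a0 : a != 0.
  apply: contraNneq ha => ->; case: hFq => F1 FB _.
  by rewrite -(subrr 1) FB.
have muP (x : F) : reflect (x ^+ (q + 1) = 1) (x \in mu F (q + 1)).
  by rewrite inE; apply: unity_rootP.
have mu_exp (x : F) : x != 0 -> x ^+ (q - 1) \in mu F (q + 1).
  move=> x0; apply/muP; rewrite -exprM -cardF1; apply: (mulfI x0).
  by rewrite -exprS mulr1 prednK ?expf_card // hF expn_gt0 q_gt0.
have mu_neq0 (u : F) : u \in mu F (q + 1) -> u != 0.
  move/muP=> u1; apply: contra_eq_neq u1 => ->.
  by rewrite expr0n addn1 eq_sym oner_neq0.
pose h u := B.[u] * (a * u ^+ 3 + a ^+ q).
have fE x : f x = x ^+ s * h (x ^+ (q - 1)).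
  rewrite /f !(hornerM, hornerD, hornerZ, hornerXn, hornerC) horner_comp hornerXn.
  by rewrite [(3 * _)%N]mulnC exprM -mulrA.
have f0 : f 0 = 0 by rewrite fE expr0n gtn_eqF // mul0r.
have cubeP : - a ^+ (q - 1) \notin mu F ((q + 1) %/ gcdn (q + 1) 3) <->
    (forall u, u \in mu F (q + 1) -> a * u ^+ 3 + a ^+ q != 0).
  have rootE u : (a * u ^+ 3 + a ^+ q == 0) = (- a ^+ (q - 1) == u ^+ 3).
    have -> : a ^+ q = a * a ^+ (q - 1) by rewrite -exprS -addn1 subnK.
    rewrite -mulrDr mulf_eq0 (negPf a0) /=.
    by rewrite eqr_oppLR -addr_eq0 addrC addrC.
  split=> [not_cube u mu_u | no_root].
    apply: contra not_cube; rewrite rootE inE => /eqP->.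
    apply/unity_rootP; rewrite -exprM.
    (* Three times [(q + 1) / gcd] equals [q + 1] times [3 / gcd], a multiple of the order of
       [u]. *)
    rewrite [gcdn _ 3]gcdnC muln_divCA_gcd.
    by rewrite exprM (muP _ mu_u) expr1n.
  apply/negP; rewrite inE => /unity_rootP cube1.
  have prim_zq : (q + 1).-primitive_root (z ^+ (q - 1)).
    have := dvdn_prim_root prim_z (dvdn_mull (q - 1) (dvdnn (q + 1))).
    by rewrite mulnK // addn1.
  have [u u1 au] := prim_root_powP (isT : 0 < 3)%N prim_zq cube1.
  by have := no_root u (introT (muP u) u1); rewrite rootE au eqxx.
have hpow u : u \in mu F (q + 1) -> a * u ^+ 3 + a ^+ q != 0 ->
    u ^+ s * h u ^+ (q - 1) = u ^+ r * (coef_pow q B).[u^-1] / B.[u].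
  move=> mu_u c0; have u0 := mu_neq0 u mu_u.
  have B0 : B.[u] != 0 := hBroot u mu_u.
  have uq : u ^+ q = u^-1.
    by apply: (mulIf u0); rewrite mulVf // -exprSr -addn1 (muP u mu_u).
  (* Exponents of [u] count modulo [q + 1]. The extra [u ^+ 3] will absorb the [u ^- 3] that the
     cubic factor acquires under the [q]-th power. *)
  have us : u ^+ s = u ^+ r * u ^+ 3.
    rewrite -exprD -(expr_mod s (muP u mu_u)) hrs.
    by rewrite (expr_mod _ (muP u mu_u)).
  have aqq : a ^+ q ^+ q = a by rewrite -exprM mulnn -hF expf_card.
  have cq : (a * u ^+ 3 + a ^+ q) ^+ q * u ^+ 3 = a * u ^+ 3 + a ^+ q.
    rewrite exprDn_pchar // aqq exprMn exprAC uq mulrDl -mulrA -exprMn.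
    by rewrite mulVf // expr1n mulr1 addrC.
  have h0 : h u != 0 by rewrite mulf_neq0.
  have -> : h u ^+ (q - 1) = h u ^+ q / h u.
    by apply: (canRL (mulfK h0)); rewrite -exprSr -addn1 subnK.
  rewrite us /h exprMn (horner_coef_pow _ _ char_q) uq.
  move: cq c0; set c := a * _ + _ => cq c0.
  have c1 : c ^+ q * u ^+ 3 / c = 1 by rewrite cq divff.
  rewrite -[RHS]mulr1 -c1 invfM; ring.
rewrite permutes_setT cubeP; split=> [f_inj | [gcd1 no_root] x y fxy].
  split=> [|u mu_u].
    (* A primitive [d]-th root of unity [w] has [w ^+ s = w ^+ (q - 1) = 1], so [f w = f 1];
       injectivity gives [w = 1], hence [d = 1]. *)
    have d_q1 := dvdn_gcdr s (q - 1).
    have d_s := dvdn_gcdl s (q - 1).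
    set d := gcdn s (q - 1) in d_q1 d_s *.
    have prim_w := dvdn_prim_root prim_z (dvdn_mulr (q + 1) d_q1).
    set w := z ^+ _ in prim_w.
    have w1 n : (d %| n)%N -> w ^+ n = 1.
      by rewrite (prim_order_dvd prim_w) => /eqP.
    have w_eq1 : w = 1 by apply: f_inj; rewrite !fE !w1 // !expr1n.
    by apply/eqP; rewrite -dvdn1 (prim_order_dvd prim_w) w_eq1 expr1n.
  (* Every [u] in [mu F (q + 1)] is some [x ^+ (q - 1)]. If the cubic factor vanished at [u], then
     [f x = 0 = f 0] would give [x = 0] and [u = 0]. *)
  have gcdE : gcdn ((q - 1) * (q + 1)) (q - 1) = (q - 1)%N.
    by apply/gcdn_idPr/dvdn_mulr.
  have [] := @prim_root_powP _ _ (q - 1) z u q1_gt0 prim_z.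
    by rewrite gcdE mulKn //; apply/muP.
  move=> x _ def_u; apply: contraTneq mu_u => c0.
  suff x0 : x = 0.
    by apply/negP => /mu_neq0; rewrite def_u x0 expr0n gtn_eqF // eqxx.
  by apply: f_inj; rewrite f0 fE -def_u /h c0 !mulr0.
(* This separates the fibre over [0], so that below [x] and [y] are nonzero and their [(q - 1)]-th
   powers lie in [mu F (q + 1)]. *)
have f_eq0 t : (f t == 0) = (t == 0).
  have [-> | t0] := eqVneq t 0; first by rewrite f0 eqxx.
  have mu_t := mu_exp t t0.
  apply: negbTE; rewrite fE; apply: mulf_neq0; first exact: expf_neq0.
  by apply: mulf_neq0; [exact: hBroot | exact: no_root].
have [y0 | y0] := eqVneq y 0.
  by apply/eqP; rewrite y0 -f_eq0 fxy y0 f0.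
have x0 : x != 0 by rewrite -f_eq0 fxy f_eq0.
have fpow t : t != 0 -> f t ^+ (q - 1) =
    (t ^+ (q - 1)) ^+ r * (coef_pow q B).[(t ^+ (q - 1))^-1] / B.[t ^+ (q - 1)].
  move=> t0; have mu_t := mu_exp t t0.
  by rewrite -hpow ?no_root // fE exprMn exprAC.
have xyq : x ^+ (q - 1) = y ^+ (q - 1).
  by case: hBperm => B_inj _; apply: B_inj; rewrite ?mu_exp // -!fpow // fxy.
(* Equal [(q - 1)]-th powers give both sides of [fxy] the same nonzero factor [h]; cancelling it
   leaves [x ^+ s = y ^+ s]. *)
apply: (expf_coprime_inj y0 hs gcd1 _ xyq).
move: fxy; rewrite !fE xyq; apply: mulIf.
have mu_y := mu_exp y y0.
by apply: mulf_neq0; [exact: hBroot | exact: no_root].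
Qed.
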